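(* There exists a 5-point set $K \subseteq \mathbb{R}^{2\times 2}$ such that $L(K)$ is connected, compact and strictly smaller than $K^{rc}$, i.e. $L(K) \subsetneq K^{rc}$.
   Context: $\mathbb{R}^{2\times 2}$ is the space of real $2\times 2$ matrices. Two matrices $X,Y$ are rank-one connected if $\operatorname{rank}(X-Y)=1$. A set $\mathcal{S} \subseteq \mathbb{R}^{2\times 2}$ is lamination convex if $\lambda X + (1-\lambda) Y \in \mathcal{S}$ for all $\lambda \in [0,1]$ whenever $X,Y \in \mathcal{S}$ are rank-one connected. For $K \subseteq \mathbb{R}^{2 \times 2}$, $L(K)$ is the smallest lamination convex set containing $K$. A function $f : \mathbb{R}^{2\times 2} \to \mathbb{R}$ is rank-one convex if $f(\lambda X + (1-\lambda)Y) \leq \lambda f(X) + (1-\lambda) f(Y)$ for all $\lambda \in [0,1]$ whenever $\operatorname{rank}(X-Y) \leq 1$. The rank-one convex hull of a compact set $K \subseteq \mathbb{R}^{2\times 2}$ is \[ K^{rc} = \{ X \in \mathbb{R}^{2\times 2} : f(X) \leq 0 \text{ for every rank-one convex } f : \mathbb{R}^{2\times 2}\to\mathbb{R} \text{ with } f|_K \leq 0 \}. \] *)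

(* Defs.v *)
From mathcomp Require Import all_boot all_order all_algebra.
From mathcomp Require Import all_classical all_reals all_analysis.

Set Implicit Arguments.
Unset Strict Implicit.
Unset Printing Implicit Defensive.

Import Order.TTheory GRing.Theory Num.Theory.
Import numFieldNormedType.Exports.

Local Open Scope classical_set_scope.
Local Open Scope ring_scope.

Definition rank_one_connected (R : realType) (X Y : 'M[R]_2) : Prop :=
  \rank (X - Y) = 1%N.

Definition lamination_convex (R : realType) (S : set 'M[R]_2) : Prop :=
  forall X Y : 'M[R]_2, S X -> S Y -> rank_one_connected X Y ->
  forall l : R, 0 <= l <= 1 -> S (l *: X + (1 - l) *: Y).

Definition lamination_hull (R : realType) (K : set 'M[R]_2) : set 'M[R]_2 :=
  smallest (@lamination_convex R) K.

Definition rank_one_convex (R : realType) (f : 'M[R]_2 -> R) : Prop :=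
  forall X Y : 'M[R]_2, (\rank (X - Y)%R <= 1)%N ->
  forall l : R, 0 <= l <= 1 ->
  f (l *: X + (1 - l) *: Y) <= l * f X + (1 - l) * f Y.

(* Meant for compact K, although the formula makes sense for any set. *)
Definition rank_one_convex_hull (R : realType) (K : set 'M[R]_2) :
    set 'M[R]_2 :=
  [set X | forall f : 'M[R]_2 -> R, rank_one_convex f ->
           (forall Y, K Y -> f Y <= 0) -> f X <= 0].

(* Main.v *)
Require Import Defs.
From mathcomp Require Import all_boot all_order all_algebra.
From mathcomp Require Import all_classical all_reals all_analysis.
From mathcomp Require Import ring lra.
Import Order.TTheory GRing.Theory Num.Theory.
Import numFieldNormedType.Exports.

(** The set [K] consists of the origin and a Tartar square (T4 configuration)
    [T1, ..., T4] of rank-one matrices. Then [L(K)] is the star made of the four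
    segments [[0, Ti]]: if [det A = det B = 0] then
    [det (s A - t B) = s t det (A - B)], so no two nonzero points on distinct
    segments are rank-one connected. On the other hand there are [P1, ..., P4]
    such that [P(i+1)] is the midpoint of the rank-one segment [[Pi, Ti]]
    (cyclically), so a rank-one convex [f] with [f <= 0] on [K] satisfies
    [f P2 <= f P2 / 16]; hence [P2] lies in the rank-one convex hull, but it is
    not on the star. *)

Local Open Scope classical_set_scope.
Local Open Scope card_scope.
Local Open Scope ring_scope.

(** * Determinants and rank in size two *)

Section Two_by_two.
Context {F : fieldType}.
Implicit Types A B : 'M[F]_2.

Lemma det_mx22 A : \det A = A 0 0 * A 1 1 - A 0 1 * A 1 0.
Proof.
have l0 : lift 0 0 = 1 :> 'I_2 by exact: val_inj.
have l1 : lift 1 0 = 0 :> 'I_2 by exact: val_inj.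
rewrite (expand_det_row _ 0) !big_ord_recl big_ord0 addr0 /cofactor !l0.
by rewrite !det_mx11 !mxE !l0 l1 /= expr0 expr1 mul1r mulN1r mulrN.
Qed.

Lemma rank_le1_det A : (\rank A <= 1)%N = (\det A == 0).
Proof.
have := row_free_unit A; rewrite unitmxE unitfE /row_free => rA.
rewrite -[_ == 0]negbK -rA; have := rank_leq_row A.
by case: (\rank A) => [|[|[|]]].
Qed.

(** In size two the determinant is a quadratic form. It vanishes at [A] and [B], so only the mixed
    term survives, and that term is bilinear. *)
Lemma det_pencil A B s t : \det A = 0 -> \det B = 0 ->
  \det (s *: A - t *: B) = s * t * \det (A - B).
Proof.
rewrite !det_mx22 !mxE => dA dB.
transitivity (s * t * ((A 0 0 - B 0 0) * (A 1 1 - B 1 1) -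
    (A 0 1 - B 0 1) * (A 1 0 - B 1 0))
  + (s ^+ 2 - s * t) * (A 0 0 * A 1 1 - A 0 1 * A 1 0)
  + (t ^+ 2 - s * t) * (B 0 0 * B 1 1 - B 0 1 * B 1 0)); first by ring.
by rewrite dA dB !mulr0 !addr0.
Qed.

Definition mx22 (a b c d : F) : 'M[F]_2 :=
  \matrix_(i, j) (if i == 0 then if j == 0 then a else b
                  else if j == 0 then c else d).

Lemma det_mx22B a b c d a' b' c' d' :
  \det (mx22 a b c d - mx22 a' b' c' d') =
  (a - a') * (d - d') - (b - b') * (c - c').
Proof. by rewrite det_mx22 !mxE. Qed.

Lemma comb_mx22 s t a b c d a' b' c' d' :
  s *: mx22 a b c d + t *: mx22 a' b' c' d' =
  mx22 (s * a + t * a') (s * b + t * b') (s * c + t * c') (s * d + t * d').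
Proof. by apply/matrixP => i j; rewrite !mxE; case: ifP; case: ifP. Qed.

Lemma mx22_eq0 a b c d :
  (mx22 a b c d == 0) = [&& a == 0, b == 0, c == 0 & d == 0].
Proof.
apply/eqP/and4P => [/matrixP E|[/eqP-> /eqP-> /eqP-> /eqP->]].
  by move: (E 0 0) (E 0 1) (E 1 0) (E 1 1); rewrite !mxE /= => -> -> -> ->.
by apply/matrixP => i j; rewrite !mxE; case: ifP; case: ifP.
Qed.

End Two_by_two.

Lemma rank_one_connectedE {R : realType} (X Y : 'M[R]_2) :
  rank_one_connected X Y <-> X != Y /\ \det (X - Y) = 0.
Proof.
rewrite /rank_one_connected -subr_eq0 -mxrank_eq0.
split=> [r1|[r0 /eqP]].
  by split; [rewrite r1|apply/eqP; rewrite -rank_le1_det r1].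
by rewrite -rank_le1_det; case: (\rank _) r0 => [|[|]].
Qed.

Lemma card_set_seq {T : eqType} (s : seq T) :
  uniq s -> [set` s] #= `I_(size s).
Proof.
(* Only a nonempty list supplies a default for [nth], which is injective on valid indices because
   the entries are distinct. *)
case: s => [_|x s us]; first by rewrite set_nil II0 card_eq00.
have -> : [set` x :: s] = nth x (x :: s) @` `I_(size (x :: s)).
  apply/seteqP; split => [y /nthP-/(_ x)[i ? <-]|_ [i ? <-]]; first by exists i.
  exact: mem_nth.
apply: inj_card_eq => i j; rewrite !inE => /= ? ? /eqP.
by rewrite nth_uniq // => /eqP.
Qed.

(** * Stars of segments issuing from the origin *)

Section Star.
Context {R : realType}.
Implicit Types (K : set 'M[R]_2) (X Y : 'M[R]_2).

Definition star K : set 'M[R]_2 :=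
  \bigcup_(A in K) ((fun t : R => t *: A) @` `[0, 1]).

Lemma starP K X : star K X <->
  exists A t, [/\ K A, 0 <= t <= 1 & X = t *: A].
Proof.
split=> [[A KA [t /=]]|[A [t [KA t01 ->]]]].
  by rewrite in_itv /= => t01 <-; exists A, t.
by exists A => //; exists t; rewrite //= in_itv.
Qed.

Lemma star_compact K : finite_set K -> compact (star K).
Proof.
move=> /finite_compact cK.
have -> : star K = (fun x => x.1 *: x.2) @` (`[0, 1] `*` K).
  apply/seteqP; split => [_ [A KA [t t01 <-]]|_ [[t A] [/= t01 KA] <-]].
    by exists (t, A).
  by exists A => //; exists t.
apply: continuous_compact; last exact/compact_setX/cK/segment_compact.
apply: continuous_subspaceT => x.
exact: (@scale_continuous R 'M[R]_2).
Qed.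

Lemma star_connected K : connected (star K).
Proof.
apply: bigcup_connected => [|A _].
  exists 0 => A _; exists 0; last by rewrite scale0r.
  by rewrite /= in_itv /= lexx ler01.
apply: connected_continuous_connected; first exact: segment_connected.
apply: continuous_subspaceT => t; exact: (@scalel_continuous R 'M[R]_2).
Qed.

(** By [det_pencil], rank-one connected points [s *: A] and [t *: B] have [s = 0], [t = 0] or
    [A = B]. Both then lie on a single segment of the star, which is convex. *)
Lemma star_lamination_convex K :
  (forall A, K A -> \det A = 0) ->
  (forall A B, K A -> K B -> ~ rank_one_connected A B) ->
  lamination_convex (star K).
Proof.
move=> K0 KK X Y /starP[A [s [KA s01 ->]]] /starP[B [t [KB t01 ->]]].
move=> /rank_one_connectedE[_].
rewrite (det_pencil _ _ _ _ (K0 _ KA) (K0 _ KB)).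
move=> /eqP; rewrite !mulf_eq0 -orbA => st l l01; apply/starP.
have conv (a b : R) : 0 <= a <= 1 -> 0 <= b <= 1 ->
    0 <= l * a + (1 - l) * b <= 1.
  move: l01 => /andP[? ?] /andP[? ?] /andP[? ?].
  by apply/andP; split; nra.
case/or3P: st => [/eqP s0|/eqP t0|/eqP dAB].
- exists B, (l * s + (1 - l) * t); split; rewrite ?conv//.
  by rewrite s0 mulr0 add0r scale0r scaler0 add0r scalerA.
- exists A, (l * s + (1 - l) * t); split; rewrite ?conv//.
  by rewrite t0 mulr0 addr0 scale0r scaler0 addr0 scalerA.
- have AB : A = B.
    apply/eqP; apply: contra_notT (KK _ _ KA KB) => AB.
    by apply/rank_one_connectedE.
  exists A, (l * s + (1 - l) * t); split; rewrite ?conv//.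
  by rewrite -AB !scalerA scalerDl.
Qed.

Lemma lamination_hull_star K :
  K !=set0 ->
  (forall A, K A -> rank_one_connected A 0) ->
  (forall A B, K A -> K B -> ~ rank_one_connected A B) ->
  lamination_hull (0 |` K) = star K.
Proof.
move=> [A0 KA0] K0 KK; apply/seteqP; split.
  apply: smallest_sub.
    apply: star_lamination_convex => // A /K0/rank_one_connectedE[_].
    by rewrite subr0.
  move=> X [->|KX]; apply/starP.
    by exists A0, 0; rewrite scale0r lexx ler01.
  by exists X, 1; rewrite scale1r lexx ler01.
move=> X /starP[A [t [KA t01 ->]]] S [Sconv KS].
(* The point becomes a combination of [A] and the origin, which are rank-one connected. *)
rewrite -[t *: A]addr0 -[0](scaler0 _ (1 - t)).
apply: Sconv => //; [|exact/KS/or_introl|exact: K0].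
by apply: KS; right.
Qed.

(** Zero sublevel sets of rank-one convex functions are lamination convex. *)
Lemma lamination_hull_sub_rank_one K :
  lamination_hull K `<=` rank_one_convex_hull K.
Proof.
move=> X LX f fc f0; apply: (LX [set Y | f Y <= 0]); split => // Y Z /= fY fZ.
rewrite /rank_one_connected => r1 l l01.
by apply: le_trans (fc _ _ _ _ l01) _; rewrite ?r1//; nra.
Qed.

End Star.

(** * The Tartar square *)

Section Tartar_square.
Context {R : realType}.

(* Found by prescribing [det Ti = 0] and [d_ij = det (Ti - Tj)]: a zero-diagonal
   symmetric matrix of signature (2,2) is realised by rank-one matrices, and
   Szekelyhidi's criterion asks for [mu > 1] and [l > 0] in the kernel of the
   matrix with entries [d_ij] above and [mu d_ij] below the diagonal; here
   [mu = 16] and [l = (1,2,4,8)]. *)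
Definition tartar_square : seq 'M[R]_2 :=
  [:: mx22 2 0 0 0; mx22 0 0 0 2; mx22 (-2) 3 (-2) 3; mx22 (-3) 6 1 (-2)].

Lemma tartar_square_pairwise :
  pairwise (fun A B : 'M[R]_2 => \det (A - B) != 0) tartar_square.
Proof.
rewrite /= !det_mx22B !andbT.
by repeat (apply/andP; split);
  rewrite neq_lt; apply/orP; (left; lra) || (right; lra).
Qed.

Lemma tartar_square_rank_one (A : 'M[R]_2) :
  A \in tartar_square -> rank_one_connected A 0.
Proof.
move=> sA; apply/rank_one_connectedE; rewrite subr0.
suff: (A != 0) && (\det A == 0) by move=> /andP[? /eqP].
move: A sA; apply/allP.
rewrite /= !mx22_eq0 !(oppr_eq0, pnatr_eq0) /= !andbF /=.
rewrite !det_mx22 !mxE /= andbT.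
by apply/and4P; split; apply/eqP; ring.
Qed.

Lemma tartar_square_not_connected (A B : 'M[R]_2) :
  A \in tartar_square -> B \in tartar_square -> ~ rank_one_connected A B.
Proof.
move=> sA sB /rank_one_connectedE[AB dAB].
(* [tartar_square_pairwise] covers pairs in list order only. Being reflexive and symmetric, [r]
   extends from these to all pairs. *)
pose r (X Y : 'M[R]_2) := (\det (X - Y) == 0) ==> (X == Y).
have rr : reflexive r by move=> X; rewrite /r eqxx implybT.
have rs : symmetric r.
  move=> X Y.
  by rewrite /r -(opprB Y X) -scaleN1r detZ sqrrN expr1n mul1r (eq_sym X).
have : all2rel r tartar_square.
  rewrite -pairwise_all2rel//.
  apply: sub_pairwise tartar_square_pairwise => X Y.
  by rewrite /r => /negPf ->.
by move=> /allrelP/(_ _ _ sA sB); rewrite /r dAB eqxx (negPf AB).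
Qed.

Lemma tartar_square_uniq : uniq (0 :: tartar_square).
Proof.
rewrite cons_uniq uniq_pairwise; apply/andP; split.
  by apply/negP => /tartar_square_rank_one/rank_one_connectedE[/eqP].
apply: sub_pairwise tartar_square_pairwise => A B /=.
by apply: contra_neq => ->; rewrite subrr det0.
Qed.

Lemma tartar_square_rank_one_convex_hull (K : set 'M[R]_2) :
  [set` tartar_square] `<=` K -> rank_one_convex_hull K (mx22 0 2 0 0).
Proof.
move=> sK f fc f0.
(* As [f T <= 0], convexity along the segment from [P] to [T] loses its [T] term. *)
have mid (P Q T : 'M[R]_2) : T \in tartar_square -> \det (P - T) = 0 ->
    Q = 2^-1 *: P + 2^-1 *: T -> f Q <= 2^-1 * f P.
  move=> /sK/f0 fT /eqP; rewrite -rank_le1_det => /fc/(_ 2^-1).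
  have -> : 1 - 2^-1 = 2^-1 :> R by lra.
  by move=> h ->; have := h ltac:(lra); lra.
(* Unrolling the cycle of midpoints forces P1 = (T1 + 2 T2 + 4 T3 + 8 T4) / 15, which is
   [mx22 (-2) 4 0 0]; P2, P3 and P4 follow by taking midpoints. *)
have f12 : f (mx22 0 2 0 0) <= 2^-1 * f (mx22 (-2) 4 0 0).
  apply: (mid _ _ (mx22 2 0 0 0));
    rewrite ?inE ?eqxx ?orbT ?det_mx22B ?comb_mx22//.
    by ring.
  by congr mx22; field.
have f23 : f (mx22 0 1 0 1) <= 2^-1 * f (mx22 0 2 0 0).
  apply: (mid _ _ (mx22 0 0 0 2));
    rewrite ?inE ?eqxx ?orbT ?det_mx22B ?comb_mx22//.
    by ring.
  by congr mx22; field.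
have f34 : f (mx22 (-1) 2 (-1) 2) <= 2^-1 * f (mx22 0 1 0 1).
  apply: (mid _ _ (mx22 (-2) 3 (-2) 3));
    rewrite ?inE ?eqxx ?orbT ?det_mx22B ?comb_mx22//.
    by ring.
  by congr mx22; field.
have f41 : f (mx22 (-2) 4 0 0) <= 2^-1 * f (mx22 (-1) 2 (-1) 2).
  apply: (mid _ _ (mx22 (-3) 6 1 (-2)));
    rewrite ?inE ?eqxx ?orbT ?det_mx22B ?comb_mx22//.
    by ring.
  by congr mx22; field.
lra.
Qed.

(** The first two generators vanish at entry (0, 1), where the point has 2; the other two are
    nonzero at entry (1, 0), where the point has 0, which forces [t = 0]. *)
Lemma tartar_square_notin_star : ~ star [set` tartar_square] (mx22 0 2 0 0).
Proof.
move=> /starP[A [t [sA _ /matrixP E]]].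
have := E 0 0; have := E 0 1; have := E 1 0; rewrite !mxE /=.
by move: sA; rewrite /= !inE => /or4P[] /eqP ->; rewrite !mxE /=; lra.
Qed.

End Tartar_square.

Theorem proposition2p5 (R : realType) :
  exists K : set 'M[R]_2,
    [/\ K #= `I_5,
        connected (lamination_hull K),
        compact (lamination_hull K) &
        lamination_hull K `<` rank_one_convex_hull K].
Proof.
have LK : lamination_hull (0 |` [set` @tartar_square R]) =
    star [set` tartar_square].
  apply: lamination_hull_star.
    by exists (mx22 2 0 0 0); rewrite /= inE eqxx.
    exact: tartar_square_rank_one.
  exact: tartar_square_not_connected.
exists (0 |` [set` tartar_square]); rewrite properEneq; split.
- have -> : 0 |` [set` tartar_square] =
      [set` 0 :: tartar_square] :> set 'M[R]_2.
    apply/predeqP => X /=; rewrite inE.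
    by split => [?|/predU1P]; first exact/predU1P.
  exact: card_set_seq tartar_square_uniq.
- by rewrite LK; exact: star_connected.
- by rewrite LK; apply: star_compact; exact: finite_seq.
split; last exact: lamination_hull_sub_rank_one.
apply/eqP => LK'; apply: (@tartar_square_notin_star R); rewrite -LK LK'.
by apply: tartar_square_rank_one_convex_hull => A; right.
Qed.
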